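(* For every graph model $\mathcal{G}$ there is a graph model $\mathcal{G}'$ which has a countable web and the same order theory as $\mathcal{G}$, i.e. $\mathrm{Th}_{\sqsubseteq}(\mathcal{G}')=\mathrm{Th}_{\sqsubseteq}(\mathcal{G})$ (and hence the same equational theory, $\mathrm{Th}(\mathcal{G}')=\mathrm{Th}(\mathcal{G})$).
   Context: For a set $G$, $G^*$ is the set of finite subsets of $G$. A *total pair* is a pair $(G,i)$ with $G$ an infinite set and $i:G^*\times G\to G$ an injective total function. The *graph model* $\mathcal{G}$ with web $(G,i)$ is the $\lambda$-model carried by the powerset $\mathcal{P}(G)$ ordered by inclusion in which, for $\rho:\mathrm{Var}\to\mathcal{P}(G)$, untyped $\lambda$-terms are interpreted by $|x|_\rho=\rho(x)$, $|MN|_\rho=\{\alpha\in G:\exists a\subseteq|N|_\rho\text{ finite},\ i(a,\alpha)\in|M|_\rho\}$, $|\lambda x.M|_\rho=\{i(a,\alpha):a\in G^*,\ \alpha\in|M|_{\rho[x:=a]}\}$. The web is countable if $G$ is countable. $\mathrm{Th}_{\sqsubseteq}(\mathcal{G})=\{(M,N):|M|_\rho\subseteq|N|_\rho\ \forall\rho\}$ and $\mathrm{Th}(\mathcal{G})=\{(M,N):|M|_\rho=|N|_\rho\ \forall\rho\}$. *)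

(* Defs.v *)
From mathcomp Require Import all_boot finmap.
From mathcomp Require Import mathcomp_extra boolp classical_sets functions cardinality.
Set Implicit Arguments.
Unset Strict Implicit.
Unset Printing Implicit Defensive.

Local Open Scope classical_set_scope.

Definition var : Type := nat.

(* Terms are not quotiented by alpha-conversion: [interp] does not distinguish
   alpha-equivalent terms. *)
Inductive term : Type :=
| Var of var
| App of term & term
| Lam of var & term.

(* Taking the web to be a [choiceType] gives access to [{fset web}]; under the
   axioms of [boolp] it excludes no type, cf. [{classic T}]. *)
Record total_pair : Type := TotalPair {
  web :> choiceType;
  code : {fset web} * web -> web;
  web_infinite : infinite_set [set: web];
  code_inj : injective code }.

Section GraphModel.
Variable G : total_pair.

Definition env : Type := var -> set G.

Definition upd (rho : env) (x : var) (A : set G) : env :=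
  fun y => if y == x then A else rho y.

Fixpoint interp (M : term) (rho : env) : set G :=
  match M with
  | Var x => rho x
  | App M N => [set alpha | exists a : {fset G},
      [set` a] `<=` interp N rho /\ interp M rho (code (a, alpha))]
  | Lam x M => [set beta | exists (a : {fset G}) (alpha : G),
      interp M (upd rho x [set` a]) alpha /\ beta = code (a, alpha)]
  end.

Definition Th_le : set (term * term) :=
  [set MN | forall rho : env, interp MN.1 rho `<=` interp MN.2 rho].

Definition Th_eq : set (term * term) :=
  [set MN | forall rho : env, interp MN.1 rho = interp MN.2 rho].

End GraphModel.

(* Main.v *)
Require Import Defs.
From mathcomp Require Import all_boot finmap.
From mathcomp Require Import mathcomp_extra boolp classical_sets functions cardinality.

Local Open Scope classical_set_scope.

(** The theorem is a downward Loewenheim-Skolem theorem for graph models.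
    Inclusion is not inherited by an arbitrary subset of the web that is closed
    under coding: an element of the subset may belong to an application only
    because of a finite argument that is not contained in the subset, so
    interpretations can shrink.  The cure is to look for a countable subset that
    also contains the witnesses of such memberships.

    That countably many closure conditions suffice is due to continuity
    ([interp_continuous]): an element of [interp M rho] already belongs to
    [interp M rho'] for an environment [rho'] below [rho] with finite graph.  A
    finite environment consists of a finite list of variables and a finite list
    of elements of the web, hence each condition has the form: given a finite
    list of elements of the subset, some further finite list must be found in
    the subset.  [skolem_closure] produces a countable subset that meets
    countably many conditions of this form.

    Five kinds of conditions are imposed ([requirements]).  Three make the subset
    infinite and closed under coding and decoding, so that it is the web of a
    graph model.  The fourth supplies the witnesses for applications; with it,
    the interpretation in the small model is the trace of the one in the large
    model ([interp_elementary]), and every inclusion that holds in the large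
    model holds in the small one.  The fifth places in the subset, for each of
    the countably many pairs of terms whose inclusion fails in the large model,
    a finite environment and an element at which it fails; by the same trace
    property the inclusion fails in the small model as well.  The equational
    theory is determined by the order theory ([Th_eqE]). *)

(** * Closing under Skolem functions *)

Lemma map_preimage {T U : eqType} (h : T -> U) (s : seq U) :
  [set` s] `<=` range h -> exists t, s = map h t.
Proof.
elim: s => [|y s IH] sh; first by exists [::].
have [x _ hx] : range h y by apply: sh; rewrite /= inE eqxx.
have [t ->] : exists t, s = map h t.
  by apply: IH => z zs; apply: sh; rewrite /= inE (_ : z \in s) // orbT.
by exists (x :: t); rewrite /= hx.
Qed.

Lemma fset_preimage {T U : choiceType} (h : T -> U) (b : {fset U}) :
  [set` b] `<=` range h -> exists a : {fset T}, b = [fset h x | x in a]%fset.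
Proof.
move=> /(@map_preimage _ _ h (enum_fset b))[t bt].
exists [fset x in t]%fset; apply/fsetP => y.
rewrite -[y \in b]/(y \in enum_fset b) bt.
by apply/mapP/imfsetP => -[x xt ->]; exists x => //; move: xt; rewrite !inE.
Qed.

(** The elements obtained by iterating Skolem functions are the values of finite
    trees: a node carries the number of a relation and a position in the list
    that the Skolem function of this relation returns on the values of the
    children.  There are countably many such trees, and their values are closed
    under the Skolem functions because a finite list of values comes from a
    finite list of trees, which can be grafted below a new root. *)
Lemma skolem_closure {T : choiceType} (x0 : T) (F : set (seq T -> seq T -> Prop)) :
  countable F ->
  exists S : set T, countable S /\
    forall R s, F R -> [set` s] `<=` S -> (exists t, R s t) ->
      exists2 t, R s t & [set` t] `<=` S.
Proof.
move=> /countable_injP[num num_inj].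
pose rel n := xget (fun _ _ => False) [set R | F R /\ num R = n].
have relK R : F R -> rel (num R) = R.
  rewrite /rel => FR; case: xgetP => [R' _ [FR' eqR]|/(_ R)[]//].
  by apply: num_inj => //; apply: mem_set.
pose skolem n s := xget [::] [set t | rel n s t].
(* Leaves and ill-formed labels only need some value; the constants of the
   construction come from nodes without children. *)
pose eval := fix eval (w : GenTree.tree nat) : T :=
  match w with
  | GenTree.Leaf _ => x0
  | GenTree.Node p ws =>
      if choice.unpickle p is Some (n, i) then nth x0 (skolem n (map eval ws)) i
      else x0
  end.
exists (range eval); split.
  by apply: sub_countable (card_image_le _ _) (countableP _).
move=> R s FR /map_preimage[ws ->] Rs.
exists (skolem (num R) (map eval ws)).
  by rewrite /skolem relK //; exact: xgetPex.
move=> _ /(nthP x0)[i _ <-].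
exists (GenTree.Node (choice.pickle (num R, i)) ws) => //=.
by rewrite choice.pickleK.
Qed.

(** * Continuity *)

Fixpoint term_tree (M : term) : GenTree.tree nat :=
  match M with
  | Var x => GenTree.Leaf x
  | App M N => GenTree.Node 0 [:: term_tree M; term_tree N]
  | Lam x M => GenTree.Node 1 [:: GenTree.Leaf x; term_tree M]
  end.

Lemma term_tree_inj : injective term_tree.
Proof.
elim=> [x|M IHM N IHN|x M IH] [y|M' N'|y M'] //=.
- by case=> ->.
- by case=> /IHM-> /IHN->.
- by case=> -> /IH->.
Qed.

(** An environment with a finite graph, as a list of pairs; several pairs with
    the same variable contribute several elements to its value. *)
Definition finenv {G : total_pair} (s : seq (var * G)) : env G :=
  fun x => [set y | (x, y) \in s].

Section Interpretation.
Context {G : total_pair}.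
Implicit Types (M N : term) (rho : env G) (s : seq (var * G)).

Lemma interp_mono M rho rho' :
  (forall x, rho x `<=` rho' x) -> interp M rho `<=` interp M rho'.
Proof.
elim: M rho rho' => [x|M IHM N IHN|x M IH] rho rho' le_rho //=.
- move=> alpha [a [aN aM]]; exists a; split; last exact: IHM aM.
  by apply: subset_trans aN _; exact: IHN.
- move=> beta [a [alpha [aM ->]]]; exists a, alpha; split => //.
  by apply: (IH _ _ _ _ aM) => y z; rewrite /upd; case: eqP => // _; exact: le_rho.
Qed.

Lemma finenv_mono s s' :
  {subset s <= s'} -> forall x, finenv s x `<=` finenv s' x.
Proof. by move=> ss' x y; exact: ss'. Qed.

(** Each of finitely many elements may need a different finite environment;
    concatenating the lists gives one that serves them all.  In
    [interp_continuous] the elements are those of the argument of an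
    application. *)
Lemma finenv_choice rho (P : G -> set (seq (var * G))) (l : seq G) :
  (forall y s s', {subset s <= s'} -> P y s -> P y s') ->
  (forall y, y \in l -> exists2 s, P y s & forall x, finenv s x `<=` rho x) ->
  exists2 s, (forall y, y \in l -> P y s) & forall x, finenv s x `<=` rho x.
Proof.
move=> Pmono; elim: l => [|z l IH] Pl; first by exists [::] => // x y.
have [s Ps s_rho] := Pl z (mem_head _ _).
have [|s' Ps' s'_rho] := IH; first by move=> y yl; apply: Pl; rewrite inE yl orbT.
exists (s ++ s').
  move=> y; rewrite inE => /predU1P[->|yl].
    by apply: (Pmono _ _ _ _ Ps) => p ps; rewrite mem_cat ps.
  by apply: (Pmono _ _ _ _ (Ps' y yl)) => p ps; rewrite mem_cat ps orbT.
by move=> x y; rewrite /finenv /= mem_cat => /orP[]; [exact: s_rho|exact: s'_rho].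
Qed.

Lemma interp_continuous M rho alpha : interp M rho alpha ->
  exists2 s, interp M (finenv s) alpha & forall x, finenv s x `<=` rho x.
Proof.
elim: M rho alpha => [x|M IHM N IHN|x M IH] rho alpha /=.
- move=> rho_alpha; exists [:: (x, alpha)]; first by rewrite /finenv /= inE.
  by move=> y z; rewrite /finenv /= inE => /eqP[-> ->].
- move=> [a [aN aM]].
  have [s sM s_rho] := IHM _ _ aM.
  have [||s' s'N s'_rho] :=
      @finenv_choice rho (fun y s => interp N (finenv s) y) (enum_fset a).
  + by move=> y t t' tt'; apply: interp_mono; exact: finenv_mono.
  + by move=> y /aN /IHN.
  exists (s ++ s').
    exists a; split.
      apply: (subset_trans s'N); apply: interp_mono; apply: finenv_mono => p ps.
      by rewrite mem_cat ps orbT.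
    by apply: (interp_mono _ _ _ _ _ sM); apply: finenv_mono => p ps; rewrite mem_cat ps.
  by move=> y z; rewrite /finenv /= mem_cat => /orP[]; [exact: s_rho|exact: s'_rho].
- move=> [a [beta [/IH[s sM s_rho] ->]]].
  (* The value of the bound variable is supplied by [upd], and the pairs that
     mention it must be dropped because they need not be below [rho]. *)
  exists [seq p <- s | p.1 != x].
    exists a, beta; split => //; apply: (interp_mono _ _ _ _ _ sM) => y z yz.
    move: (s_rho y z yz); rewrite /upd /=.
    by case: eqP => // /eqP yx _; rewrite /finenv /= mem_filter /= yx.
  move=> y z; rewrite /finenv /= mem_filter /= => /andP[/negPf yx yz].
  by move: (s_rho y z yz); rewrite /upd yx.
Qed.

End Interpretation.

(** * Elementary embeddings of webs *)

Section Embedding.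
Context {G' G : total_pair} (h : G' -> G).

Definition map_snd (s : seq (var * G')) : seq (var * G) :=
  [seq (p.1, h p.2) | p <- s].

Definition image_env (rho : env G') : env G := fun x => h @` rho x.

Lemma map_snd_preimage s :
  (forall p, p \in s -> range h p.2) -> exists s', s = map_snd s'.
Proof.
by move=> sh; apply: map_preimage => -[x y] /sh[z _ /= <-]; exists (x, z).
Qed.

(** The hypotheses under which passing along [h] does not change the membership
    of elements of [G'] in interpretations.  [elem_argument] is the Tarski-Vaught
    condition: the finite argument in the clause for applications is the only
    existential witness that codes in the range of [h] do not already provide,
    and by continuity it suffices to find it over finite environments.
    [elem_separate] concerns the reverse passage for theories, since an
    inclusion valid in [G'] is tested there only on environments that take values
    in the range of [h]. *)
Record elementary : Prop := Elementary {
  elem_inj : injective h;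
  elem_code : forall a alpha,
    h (code (a, alpha)) = code ([fset h x | x in a]%fset, h alpha);
  elem_decode : forall alpha b beta, h alpha = code (b, beta) ->
    [set` b] `<=` range h /\ range h beta;
  elem_argument : forall M N s alpha,
    interp (App M N) (finenv (map_snd s)) (h alpha) ->
    exists b : {fset G}, [/\ [set` b] `<=` range h,
      [set` b] `<=` interp N (finenv (map_snd s)) &
      interp M (finenv (map_snd s)) (code (b, h alpha))];
  elem_separate : forall M N,
    (exists (s : seq (var * G)) alpha,
      interp M (finenv s) alpha /\ ~ interp N (finenv s) alpha) ->
    exists s alpha, interp M (finenv (map_snd s)) (h alpha) /\
      ~ interp N (finenv (map_snd s)) (h alpha) }.

Hypothesis h_elem : elementary.

Lemma finenv_map_snd s : finenv (map_snd s) = image_env (finenv s).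
Proof.
apply/funext => x; apply/seteqP; split => y.
  by move=> /mapP[[z w] zw [-> ->]]; exists w.
by move=> [w xw <-]; apply/mapP; exists (x, w).
Qed.

Lemma image_env_upd rho x (a : {fset G'}) :
  image_env (upd rho x [set` a]) =
  upd (image_env rho) x [set` [fset h y | y in a]%fset].
Proof.
apply/funext => y; rewrite /image_env /upd; case: eqP => // _.
apply/seteqP; split=> z.
  by move=> [w wa <-]; apply/imfsetP; exists w.
by move=> /imfsetP[w wa ->]; exists w.
Qed.

(** From [G'] to [G], compatibility of [h] with codes suffices.  Conversely, for
    an application continuity replaces [image_env rho] by the image of a finite
    environment, where [elem_argument] applies, and for an abstraction a code in
    the range of [h] has its components in the range. *)
Lemma interp_elementary M rho alpha :
  interp M (image_env rho) (h alpha) <-> interp M rho alpha.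
Proof.
elim: M rho alpha => [x|M IHM N IHN|x M IH] rho alpha.
- split; last by exists alpha.
  by move=> [y rho_y /(elem_inj h_elem)<-].
- split; last first.
    move=> [a [aN aM]]; exists [fset h y | y in a]%fset; split.
      by move=> _ /imfsetP[y /aN yN ->]; apply/IHN.
    by rewrite -(elem_code h_elem); apply/IHM.
  move=> /interp_continuous[s sMN s_rho].
  have [s' e] : exists s', s = map_snd s'.
    by apply: map_snd_preimage => -[x y] /(s_rho x)[z _ <-]; exists z.
  move: sMN s_rho; rewrite {}e => sMN s_rho.
  have [b [/fset_preimage[a ->] aN aM]] := elem_argument h_elem _ _ _ _ sMN.
  exists a; split.
    move=> y ya; apply/IHN; apply: (interp_mono _ _ _ s_rho).
    by apply: aN; apply/imfsetP; exists y.
  apply/IHM; rewrite (elem_code h_elem).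
  exact: (interp_mono _ _ _ s_rho _ aM).
- split=> [[b [beta [bM e]]]|[a [beta [aM ->]]]]; last first.
    exists [fset h y | y in a]%fset, (h beta); split; last exact: elem_code.
    by rewrite -image_env_upd; apply/IH.
  have [/fset_preimage[a ba] [beta' _ eb]] := elem_decode h_elem _ _ _ e.
  subst b beta; exists a, beta'; split.
    by apply/IH; rewrite image_env_upd.
  by apply: (elem_inj h_elem); rewrite (elem_code h_elem).
Qed.

Lemma Th_le_elementary : Th_le G' = Th_le G.
Proof.
apply/seteqP; split=> -[M N] /= le_MN rho alpha.
  move=> Ma; apply: contrapT => Na.
  have [s sM s_rho] := interp_continuous _ _ _ Ma.
  have [|t [beta [tM tN]]] := elem_separate h_elem M N.
    exists s, alpha; split => // sN; apply: Na.
    exact: (interp_mono _ _ _ s_rho _ sN).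
  apply: tN; move: tM; rewrite finenv_map_snd => /interp_elementary tM.
  by apply/interp_elementary; exact: le_MN.
by move=> /interp_elementary Ma; apply/interp_elementary; exact: le_MN.
Qed.

End Embedding.

(** * Countable elementary subwebs *)

(** Skolem functions act on lists whereas codes take finite sets; a named
    conversion gives the codes of [encode] and [argument] a form to which
    [fset_ofK] applies. *)
Definition fset_of {T : choiceType} (s : seq T) : {fset T} := [fset x in s]%fset.

Lemma fset_ofK {T : choiceType} (a : {fset T}) : fset_of (enum_fset a) = a.
Proof. by apply/fsetP => x; rewrite inE. Qed.

Section Subweb.
Context {G : total_pair}.

(** In the conditions below, [s] lists elements already present and [t] elements
    that have to be added. *)

Definition fresh (s t : seq G) : Prop := exists2 x, x \notin s & x \in t.

Definition encode (s t : seq G) : Prop :=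
  if s is alpha :: s' then code (fset_of s', alpha) \in t else True.

Definition decode (s t : seq G) : Prop :=
  exists (b : {fset G}) beta, s = [:: code (b, beta)] /\ t = beta :: b.

(** The list [s] carries both the element [alpha] and the values of a finite
    environment, while the variables [xs] of the latter belong to the index;
    thus the family of conditions is indexed by a countable set. *)
Definition argument (MNxs : term * term * seq var) (s t : seq G) : Prop :=
  let: (M, N, xs) := MNxs in
  if s is alpha :: s' then
    let rho := finenv (zip xs s') in
    [set` t] `<=` interp N rho /\ interp M rho (code (fset_of t, alpha))
  else True.

Definition separate (MN : term * term) (s t : seq G) : Prop :=
  exists (e : seq (var * G)) alpha, [/\ interp MN.1 (finenv e) alpha,
    ~ interp MN.2 (finenv e) alpha & t = alpha :: [seq p.2 | p <- e]].

Definition requirements : set (seq G -> seq G -> Prop) :=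
  [set fresh; encode; decode] `|` range argument `|` range separate.

Lemma countable_term : countable [set: term].
Proof.
apply/countable_injP; exists (choice.pickle \o term_tree) => M N _ _ e.
exact/term_tree_inj/(pcan_inj choice.pickleK).
Qed.

Lemma countableU {T : Type} (A B : set T) :
  countable A -> countable B -> countable (A `|` B).
Proof.
by move=> cA cB; rewrite -bigcup2E; apply: bigcup_countable => // -[|[|n]] _ /=.
Qed.

Lemma countable_range {T U : Type} (f : T -> U) :
  countable [set: T] -> countable (range f).
Proof. exact: sub_countable (card_image_le _ _). Qed.

Lemma countable_requirements : countable requirements.
Proof.
have cTT : countable [set: term * term].
  by rewrite -setXTT; apply: countableX; exact: countable_term.
apply: countableU; last exact: countable_range.
apply: countableU; last first.
  apply: countable_range; rewrite -setXTT; apply: countableX => //.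
  exact: (@countableP (seq nat)).
by apply: countableU => //; exact: countableU.
Qed.

Variable S : set G.
Hypothesis S_closed : forall R s, requirements R -> [set` s] `<=` S ->
  (exists t, R s t) -> exists2 t, R s t & [set` t] `<=` S.

(** Being infinite is the property that no finite list exhausts the set, which is
    an existential condition on finite lists. *)
Lemma closed_infinite : infinite_set S.
Proof.
move=> /finite_seqP[s Ss].
have [] := S_closed fresh s; first by do 4!left.
- by rewrite Ss.
- have [x xs] : exists x, x \notin s.
    apply: contrapT => /forallNP sG; apply: (@web_infinite G).
    by apply/finite_seqP; exists s; apply/seteqP; split=> x // _; apply/negPn/negP/sG.
  by exists [:: x], x => //; rewrite inE.
- move=> t [x /negP xs xt] /(_ x xt).
  by rewrite Ss.
Qed.

Lemma closed_code (a : {fset G}) alpha :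
  [set` a] `<=` S -> S alpha -> S (code (a, alpha)).
Proof.
move=> aS alphaS.
have [] := S_closed encode (alpha :: enum_fset a).
- by do 3!left; right.
- by move=> x; rewrite /= inE => /predU1P[->|/aS].
- by exists [:: code (fset_of (enum_fset a), alpha)]; rewrite /= mem_head.
- by move=> t /=; rewrite fset_ofK => code_t; exact.
Qed.

Lemma closed_decode (b : {fset G}) beta :
  S (code (b, beta)) -> [set` b] `<=` S /\ S beta.
Proof.
move=> S_code.
have [] := S_closed decode [:: code (b, beta)].
- by do 2!left; right.
- by move=> x; rewrite /= inE => /eqP->.
- by exists (beta :: b), b, beta.
- move=> _ [b' [beta' [[/code_inj[<- <-]] ->]]] tS.
  by split=> [x xb|]; apply: tS; rewrite /= inE ?eqxx // (_ : x \in _) ?orbT.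
Qed.

Lemma val_range (a : set G) : a `<=` S -> a `<=` range (val : S -> G).
Proof. by move=> aS x /aS Sx; exists (SigSub (mem_set Sx)). Qed.

Lemma val_closed (x : S) : S (val x).
Proof. exact/set_mem/(valP x). Qed.

Lemma subweb_codeP (p : {fset S} * S) :
  code ([fset val x | x in p.1]%fset, val p.2) \in S.
Proof.
apply/mem_set/closed_code; last exact: val_closed.
by move=> _ /imfsetP[x _ ->]; exact: val_closed.
Qed.

Definition subweb_code (p : {fset S} * S) : S := SigSub (subweb_codeP p).

Lemma subweb_infinite : infinite_set [set: S].
Proof. by rewrite (eq_finite_set (card_setT S)); exact: closed_infinite. Qed.

Lemma subweb_code_inj : injective subweb_code.
Proof.
move=> [a x] [b y] /(congr1 val)/code_inj[ab /val_inj->].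
congr (_, _); apply/fsetP => z.
have /= := congr1 (fun c : {fset G} => val z \in c) ab.
by rewrite !mem_imfset //; exact: val_inj.
Qed.

Definition subweb : total_pair := TotalPair subweb_infinite subweb_code_inj.

Lemma subweb_elementary : @elementary subweb G val.
Proof.
split.
- exact: val_inj.
- by [].
- move=> alpha b beta e; have [] := closed_decode b beta.
    by rewrite -e; exact: val_closed.
  by move=> bS betaS; split; [exact: val_range|apply: (val_range S)].
- move=> M N s alpha [a [aN aM]].
  pose xs := map fst s; pose gs := map (val \o snd) s : seq G.
  have zipE : zip xs gs = map_snd (val : subweb -> G) s.
    by rewrite /xs /gs /map_snd; elim: (s) => //= p s' ->.
  have := S_closed (argument (M, N, xs)) (val alpha :: gs).
  rewrite /= zipE => -[].
  + by left; right; exists (M, N, xs).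
  + move=> x; rewrite /= inE => /predU1P[->|/mapP[p _ ->]]; exact: val_closed.
  + by exists (enum_fset a); rewrite fset_ofK.
  + move=> t [tN tM] tS; exists (fset_of t); split => // x.
      by rewrite /= inE => xt; apply: (val_range S) => //; exact: tS.
    by rewrite /= inE; exact: tN.
- move=> M N sep.
  have [] := S_closed (separate (M, N)) [::].
  + by right; exists (M, N).
  + by [].
  + by have [s [alpha [sM sN]]] := sep; eexists; exists s, alpha.
  + move=> _ [s [alpha [/= sM sN ->]]] tS.
    have [s' e] : exists s', s = map_snd (val : subweb -> G) s'.
      apply: map_snd_preimage => p ps; apply: (val_range S) => //; apply: tS.
      by rewrite /= inE map_f ?orbT.
    have [alpha' _ ealpha] : range (val : S -> G) alpha.
      by apply: (val_range S) => //; apply: tS; exact: mem_head.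
    by exists s', alpha'; rewrite -e ealpha.
Qed.

Lemma countable_subweb : countable S -> countable [set: subweb].
Proof. by rewrite -(eq_countable (card_setT S)). Qed.

End Subweb.

(** * Order theory and equational theory *)

Lemma Th_eqE (G : total_pair) :
  Th_eq G = [set MN | Th_le G MN /\ Th_le G (MN.2, MN.1)].
Proof.
apply/seteqP; split=> -[M N] /=.
  by move=> eMN; split=> rho /=; rewrite (eMN rho).
by move=> [MN NM] rho; apply/seteqP; split; [exact: MN | exact: NM].
Qed.

Theorem theorem6 (G : total_pair) :
  exists G' : total_pair,
    [/\ countable [set: G'], Th_le G' = Th_le G & Th_eq G' = Th_eq G].
Proof.
have [g0 _] : [set: G] !=set0 by apply: infinite_setN0; exact: web_infinite.
have [S [cS S_closed]] := skolem_closure g0 _ countable_requirements.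
have eq_le := Th_le_elementary _ (subweb_elementary S S_closed).
exists (subweb S S_closed); split => //; first exact: countable_subweb.
by rewrite !Th_eqE eq_le.
Qed.
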